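(* For all integers $n>1$ and $k\ge 3$, the firecracker graph $F_{n,k}$ is odd prime.
   Context: All graphs are finite and simple. A graph $G$ of order $N$ is odd prime if there is a bijection $\ell:V(G)\to\{1,3,\ldots,2N-1\}$ with $\gcd(\ell(u),\ell(v))=1$ for every edge $uv$. The firecracker $F_{n,k}$ consists of a path $v_1,\ldots,v_n$ and, for each $i$, a star with center $u_i$ and $k-2$ leaves $w_{i,1},\ldots,w_{i,k-2}$ (a star on $k-1$ vertices), together with the edge $v_iu_i$; it has $nk$ vertices. *)

(* Defs.v *)
From mathcomp Require Import all_boot.
Set Implicit Arguments. Unset Strict Implicit. Unset Printing Implicit Defensive.

Definition simple_graph (T : finType) (e : rel T) : Prop :=
  symmetric e /\ irreflexive e.

Definition odd_labels (N : nat) : seq nat := [seq (2 * i).+1 | i <- iota 0 N].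

(* Odd prime labeling: an injective map V -> {1,3,...,2|V|-1} (hence a
   bijection, both sets having |V| elements) with coprime labels on edges. *)
Definition odd_prime (T : finType) (e : rel T) : Prop :=
  exists l : T -> nat,
    [/\ injective l,
        (forall x, l x \in odd_labels #|T|) &
        (forall x y, e x y -> coprime (l x) (l y))].

(* Firecracker F_{n,k}: vertex (i, j) with i < n, j < k.
   j = 0 : path vertex v_(i+1);  j = 1 : star center u_(i+1);
   j >= 2 : star leaf w_(i+1, j-1)  (k-2 leaves per star).  nk vertices. *)
Definition fc_adj (n k : nat) (a b : 'I_n * 'I_k) : bool :=
  let i := nat_of_ord a.1 in let j := nat_of_ord a.2 in
  let i' := nat_of_ord b.1 in let j' := nat_of_ord b.2 in
  ((j == 0) && (j' == 0) && ((i.+1 == i') || (i'.+1 == i)))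
  || ((i == i') &&
      (((j == 0) && (j' == 1)) || ((j == 1) && (j' == 0))
       || ((j == 1) && (2 <= j')) || ((2 <= j) && (j' == 1)))).

Arguments fc_adj : clear implicits.
Definition firecracker (n k : nat) : rel ('I_n * 'I_k) := fc_adj n k.
Arguments firecracker : clear implicits.

(* Main.v *)
Require Import Defs.
From mathcomp Require Import all_boot all_order all_algebra.
From mathcomp Require Import perm zify ring lra.
Set Implicit Arguments. Unset Strict Implicit. Unset Printing Implicit Defensive.

(* Three regimes.
   If k <= 20, star i gets the block of k consecutive odd numbers starting at
   2ki + 1, that first number being the label of its path vertex; the block
   contains a number coprime to all the others, which labels the centre.
   If 2nk < 2^k, Chebyshev's bound pi(2N) > N log 4 / log(2N) - 1 with N = nk
   yields n - 1 primes between 2n + 1 and 2nk; they and 1 label the centres, the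
   path gets 3, 5, ..., 2n + 1, and the leaves are distributed by Hall's
   theorem, since such a prime has fewer than k - 1 further odd multiples.
   Otherwise n >= 2300 k.  Cut the labels into k intervals of n consecutive odd
   numbers (path, centres, and k - 2 layers of leaves) and match any two of
   them, I and J, by coprime pairs.  In Hall's condition one may assume, up to
   exchanging I and J, that the neighbourhood U of S has at most n/2 elements.
   By Legendre's sieve x in S has about n phi(x)/x neighbours, so x/phi(x) is
   at least about n/|U|; as x/phi(x) - 1 has mean less than 5/12 on I,
   this forces |S| <= |U|. *)

(** Every edge either joins consecutive path vertices or has a star centre at one end, and the
    centre is adjacent to all the rest of its group [i]; so two coprimality conditions suffice. *)
Lemma firecracker_labelling n k (l : 'I_n -> 'I_k -> nat) :
  (forall i j i' j', l i j = l i' j' -> i = i' /\ j = j') ->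
  (forall i j, odd (l i j)) -> (forall i j, l i j < 2 * (n * k)) ->
  (forall (i i' : 'I_n) (j : 'I_k),
     j = 0 :> nat -> i' = i.+1 :> nat -> coprime (l i j) (l i' j)) ->
  (forall (i : 'I_n) (j j' : 'I_k),
     j = 1 :> nat -> j' != j -> coprime (l i j) (l i j')) ->
  odd_prime (firecracker n k).
Proof.
move=> linj lodd llt lpath lstar; exists (fun x => l x.1 x.2); split.
- by move=> [i j] [i' j'] /= /linj [-> ->].
- case=> i j /=; apply/mapP; exists (l i j)./2.
    rewrite mem_iota card_prod !card_ord /=.
    by have := llt i j; lia.
  by have := lodd i j; lia.
case=> i j [i' j']; rewrite /firecracker /fc_adj /=.
case/orP=> [/andP[/andP[/eqP j0 /eqP j'0]]|/andP[/eqP/val_inj<-]].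
  have -> : j' = j by apply: val_inj; rewrite /= j0.
  by case/orP=> /eqP ii'; last rewrite coprime_sym; apply: lpath.
have ne (a b : 'I_k) : a <> b :> nat -> a != b by move=> ab; apply/eqP=> /(congr1 val).
case/orP=> [/orP[/orP[]|]|] /andP[/eqP h1 /eqP h2] //.
- by rewrite coprime_sym; apply: lstar => //; apply: ne; lia.
- by apply: lstar => //; apply: ne; lia.
- by apply: lstar => //; apply: ne; lia.
- by rewrite coprime_sym; apply: lstar => //; apply: ne; lia.
Qed.

(** * Hall's theorem *)

Section Hall.
Variables (S T : finType) (R : S -> T -> bool).

Let nb (B : {set T}) (X : {set S}) := [set y in B | [exists x in X, R x y]].

Let hall (A : {set S}) (B : {set T}) := forall X : {set S}, X \subset A -> #|X| <= #|nb B X|.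

(** Halmos-Vaughan induction on [#|A|]; restricting both sides to subsets keeps the statement stable
    when part of the matching is split off. [y0] is the value used when [A] is empty. *)
Lemma hall_matching_in (y0 : T) (A : {set S}) (B : {set T}) :
  hall A B -> exists f : S -> T,
    {in A &, injective f} /\ (forall x, x \in A -> (f x \in B) && R x (f x)).
Proof.
have [m] := ubnP #|A|; elim: m A B => // m IH A B /ltnSE Am hAB.
have [->|/set0Pn[a Aa]] := eqVneq A set0.
  by exists (fun=> y0); split=> x; rewrite in_set0.
(* Given a tight set [X], match it into [nb B X], and the rest of [A] outside [nb B X]. *)
have [X /and3P[XA X0 XT]|noX] :=
  pickP [pred X : {set S} | [&& X \proper A, X != set0 & #|nb B X| <= #|X|]].
  have XA' := proper_sub XA.
  have [|Z ZX|f [finj fR]] := IH X (nb B X).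
  - exact: leq_trans (proper_card XA) Am.
  - have := hAB Z (subset_trans ZX XA').
    rewrite (_ : nb B Z = nb (nb B X) Z) //; apply/setP=> y; rewrite !inE.
    case: (y \in B) => //=; apply/idP/andP=> [/existsP[x /andP[Zx xy]]|[]//].
    by split; apply/existsP; exists x; rewrite xy ?Zx // (subsetP ZX).
  have [|Z ZX|g [ginj gR]] := IH (A :\: X) (B :\: nb B X).
  - apply: leq_trans Am; apply: proper_card; rewrite properE subsetDl /=.
    case/set0Pn: X0 => x Xx; apply/subsetPn; exists x; rewrite ?inE ?Xx //.
    exact: (subsetP XA').
  - have dXZ : [disjoint Z & X].
      by apply: disjointWl ZX _; rewrite -setI_eq0 setIDAC setDIl setDv setI0.
    (* Hall's condition for [Z :|: X], less the tight count for [X], is the condition for [Z]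
       outside [nb B X]. *)
    have := hAB (Z :|: X); rewrite subUset XA' (subset_trans ZX (subsetDl _ _)) => /(_ isT).
    rewrite cardsU disjoint_setI0 // cards0 subn0 => le1.
    have le2 : nb B (Z :|: X) \subset nb (B :\: nb B X) Z :|: nb B X.
      apply/subsetP=> y; rewrite !inE => /andP[-> /existsP[x /andP[]]] /=.
      rewrite inE => /orP[Zx|Xx] xy; last first.
        by rewrite orbC (_ : [exists _ in X, _]) //; apply/existsP; exists x; rewrite Xx.
      by rewrite (_ : [exists _ in Z, _]) ?andbT ?orNb //; apply/existsP; exists x; rewrite Zx.
    have := subset_leq_card le2; have := leq_card_setU (nb (B :\: nb B X) Z) (nb B X); case=> + _.
    by move: le1 XT; lia.
  exists (fun x => if x \in X then f x else g x); split=> [x x' Ax Ax'|x Ax].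
    case: ifP => Xx; case: ifP => Xx'; first exact: finj.
    - have /andP[fx _] := fR x Xx; have := gR x'; rewrite inE Xx' Ax' => /(_ isT)/andP[gx _] e.
      by move: gx; rewrite -e inE fx.
    - have /andP[fx _] := fR x' Xx'; have := gR x; rewrite inE Xx Ax => /(_ isT)/andP[gx _] e.
      by move: gx; rewrite e inE fx.
    - by apply: ginj; rewrite inE ?Xx ?Xx'.
  case: ifP => Xx; first by have /andP[+ ->] := fR x Xx; rewrite inE => /andP[->].
  by have := gR x; rewrite inE Xx Ax => /(_ isT)/andP[+ ->]; rewrite inE => /andP[_ ->].
(* Every nonempty proper subset now has a spare neighbour, so [a] may take any neighbour [b]. *)
have [b] : exists b, b \in nb B [set a].
  by apply/set0Pn; rewrite -card_gt0; apply: leq_trans (hAB _ _); rewrite ?cards1 ?sub1set.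
rewrite inE => /andP[Bb /existsP[_ /andP[/set1P-> ab]]].
have [|Z ZA|f [finj fR]] := IH (A :\ a) (B :\ b).
- by move: Am; rewrite (cardsD1 a) Aa.
- have [->|Z0] := eqVneq Z set0; first by rewrite cards0.
  have := noX Z; rewrite /= Z0 (_ : Z \proper A) /=; last first.
    by apply: sub_proper_trans ZA _; rewrite properD1.
  move/negbT; rewrite -ltnNge.
  have : nb B Z \subset b |: nb (B :\ b) Z.
    by apply/subsetP=> y; rewrite !inE; case: (y == b).
  move/subset_leq_card; rewrite cardsU1; case: (_ \notin _); lia.
exists (fun x => if x == a then b else f x); split=> [x x' Ax Ax'|x Ax].
  case: eqP => [->|/eqP xa]; case: eqP => [->//|/eqP xa'].
  - by have := fR x'; rewrite !inE xa' Ax' => /(_ isT)/andP[/andP[/eqP h _] _] e; case: h.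
  - by have := fR x; rewrite !inE xa Ax => /(_ isT)/andP[/andP[/eqP h _] _] e; case: h.
  - by apply: finj; rewrite !inE ?xa ?xa'.
case: eqP => [->|/eqP xa]; first by rewrite Bb.
by have := fR x; rewrite !inE xa Ax => /(_ isT)/andP[/andP[_ ->] ->].
Qed.

End Hall.

Lemma hall_matching (S T : finType) (R : S -> T -> bool) (y0 : T) :
  (forall X : {set S}, #|X| <= #|[set y | [exists x in X, R x y]]|) ->
  exists2 f : S -> T, injective f & forall x, R x (f x).
Proof.
move=> h; have [X _|f [finj fR]] := @hall_matching_in _ _ R y0 [set: S] [set: T].
  rewrite (_ : [set _ in _ | _] = [set y | [exists x in X, R x y]]) //.
  by apply/setP=> y; rewrite !inE.
exists f => [x y|x]; first by apply: finj.
by have /andP[] := fR x (in_setT x).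
Qed.

(** * Stars with at most 20 vertices *)

Lemma no_common_prime_coprime m n :
  0 < m -> (forall p, prime p -> p %| m -> p %| n -> False) -> coprime m n.
Proof.
move=> m0 h; apply/negbNE/negP=> nco.
have g1 : 1 < gcdn m n by rewrite ltn_neqAle eq_sym nco gcdn_gt0 m0.
apply: (h (pdiv (gcdn m n))); first exact: pdiv_prime.
  exact: dvdn_trans (pdiv_dvd _) (dvdn_gcdl _ _).
exact: dvdn_trans (pdiv_dvd _) (dvdn_gcdr _ _).
Qed.

Lemma prime_dvd_gap p a i j : prime p -> odd a -> i <= j ->
  p %| a + 2 * i -> p %| a + 2 * j -> odd p /\ p %| j - i.
Proof.
move=> pp oa ij pi pj.
have op : odd p by apply: dvdn_odd pi _; rewrite oddD oa mul2n odd_double.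
split=> //; rewrite -(@Gauss_dvdr p 2) ?coprimen2 // mulnBr.
by rewrite -(subnDl a); apply: dvdn_sub.
Qed.

(* If [p] divides the entry [j] of the block [a, a + 2, ..., a + 2(k-1)], where
   [r] is [a] modulo [p], then it divides no other entry. *)
Definition isolated (k p r j : nat) : bool :=
  (p %| r + 2 * j) ==> (j < p) && (k <= j + p).

(* Positions of this window differ by at most 10, so each of 11 and 13 divides at
   most one of its entries; and no entry of a block of length at most 20 is at
   distance 17 or more from the window. *)
Definition middle (k : nat) : seq nat :=
  iota (maxn 1 ((k - 11) %/ 2)) (minn 11 k.-1).

Definition centre_candidates (k r3 r5 r7 : nat) : seq nat :=
  [seq j <- middle k | [&& isolated k 3 r3 j, isolated k 5 r5 j & isolated k 7 r7 j]].

(** Only residues of [a] matter, so finitely many cases are computed. For [k < 12] the odd primes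
    below [k] are among 3, 5, 7 and one candidate is enough; from 12 on, 11 and 13 may each rule out
    one candidate, hence three. *)
Lemma size_centre_candidates k a : 3 <= k -> k <= 20 ->
  (if k < 12 then 1 else 3) <= size (centre_candidates k (a %% 3) (a %% 5) (a %% 7)).
Proof.
have : all (fun k => all (fun r3 => all (fun r5 => all (fun r7 =>
    (if k < 12 then 1 else 3) <= size (centre_candidates k r3 r5 r7))
    (iota 0 7)) (iota 0 5)) (iota 0 3)) (iota 3 18) by vm_compute.
move=> /allP h k3 k20; have /h /allP/(_ (a %% 3)) : k \in iota 3 18 by rewrite mem_iota; lia.
rewrite mem_iota ltn_mod => /(_ isT)/allP/(_ (a %% 5)).
rewrite mem_iota ltn_mod => /(_ isT)/allP/(_ (a %% 7)).
by rewrite mem_iota ltn_mod; apply.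
Qed.

Lemma isolated_mod k p a j : isolated k p (a %% p) j = isolated k p a j.
Proof. by rewrite /isolated /dvdn modnDml. Qed.

(** A common prime of two entries is odd and divides the difference of their positions, hence is
    below [k]; isolation leaves it no position other than [j]. *)
Lemma isolated_coprime k a j : odd a -> j < k ->
  (forall p, prime p -> odd p -> p < k -> isolated k p a j) ->
  forall j', j' < k -> j' != j -> coprime (a + 2 * j) (a + 2 * j').
Proof.
move=> oa jk iso j' j'k jj'; apply: no_common_prime_coprime => [|p pp pj pj'].
  by case: (a) oa.
have [op pd] : odd p /\ p %| (j - j') + (j' - j).
  have [le|lt] := leqP j j'.
    by have [] := prime_dvd_gap pp oa le pj pj'; rewrite (eqP le).
  have [] := prime_dvd_gap pp oa (ltnW lt) pj' pj.
  by rewrite (eqP (ltnW lt)) addn0.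
have pk := dvdn_leq _ pd.
have /implyP/(_ pj) : isolated k p a j by apply: iso => //; lia.
lia.
Qed.

Lemma odd_prime_lt20 p : prime p -> odd p -> p < 20 ->
  p \in [:: 3; 5; 7; 11; 13; 17; 19].
Proof. by do 20?[case: p => [|p] //]. Qed.

Lemma block_centre k a : odd a -> 3 <= k -> k <= 20 ->
  exists2 j, 0 < j < k &
    forall j', j' < k -> j' != j -> coprime (a + 2 * j) (a + 2 * j').
Proof.
move=> oa k3 k20; have := size_centre_candidates a k3 k20.
set s := centre_candidates _ _ _ _ => szs.
have sP j : j \in s -> [/\ maxn 1 ((k - 11) %/ 2) <= j,
   j < maxn 1 ((k - 11) %/ 2) + minn 11 k.-1,
   isolated k 3 a j, isolated k 5 a j & isolated k 7 a j].
  rewrite mem_filter mem_iota !isolated_mod.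
  by case/andP=> /and3P[-> -> ->] /andP[-> ->].
have mid j : j \in s -> 0 < j < k by move/sP=> [h1 h2 _ _ _]; lia.
suff [j sj [i11 i13]] : exists2 j, j \in s & isolated k 11 a j /\ isolated k 13 a j.
  exists j; first exact: mid.
  have /andP[_ jk] := mid j sj; apply: isolated_coprime => // p pp op pk.
  have [h1 h2 i3 i5 i7] := sP j sj.
  have := odd_prime_lt20 pp op (leq_trans pk k20); rewrite !inE.
  do 5!case/orP=> [/eqP->//|]; case/orP=> /eqP e; rewrite /isolated; apply/implyP=> _; lia.
move: szs; case: ifP => k12 szs.
  have [j sj] : exists j, j \in s.
    by case: (s) szs => // j s' _; exists j; rewrite mem_head.
  have := mid j sj.
  by exists j => //; split; rewrite /isolated; apply/implyP=> _; lia.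
have us : uniq s by rewrite filter_uniq ?iota_uniq.
have gap p i j : prime p -> 10 < p -> i \in s -> j \in s ->
    p %| a + 2 * i -> p %| a + 2 * j -> i = j.
  move=> pp p10; wlog le : i j / i <= j => [h si sj pi pj|si sj pi pj].
    by have [/h|/ltnW/h] := leqP i j; [apply|move=> h'; apply/esym/h'].
  have [_ /dvdn_leq] := prime_dvd_gap pp oa le pi pj.
  by have [h1 h2 _ _ _] := sP i si; have [h3 h4 _ _ _] := sP j sj; lia.
case es: s szs => [|x [|y [|z s']]] // _.
have [sx sy sz] : [/\ x \in s, y \in s & z \in s] by rewrite es !inE !eqxx !orbT.
move: us; rewrite es /= !inE !negb_or -!andbA => /and5P[/eqP xy /eqP xz _ /eqP yz _].
have dec j : j \in s ->
    [\/ isolated k 11 a j /\ isolated k 13 a j, 11 %| a + 2 * j | 13 %| a + 2 * j].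
  move=> sj; rewrite /isolated; case: (11 %| _) => /=; first by constructor 2.
  by case: (13 %| _) => /=; [constructor 3|constructor 1].
rewrite -es.
(* Three candidates against two primes, each dividing at most one of them: some candidate avoids
   both. *)
case: (dec x sx) => [?|ex|ex]; first by exists x.
  case: (dec y sy) => [?|ey|ey]; first by exists y.
    by case: xy; apply: (gap 11).
  case: (dec z sz) => [?|ez|ez]; first by exists z.
    by case: xz; apply: (gap 11).
  by case: yz; apply: (gap 13).
case: (dec y sy) => [?|ey|ey]; first by exists y.
  case: (dec z sz) => [?|ez|ez]; first by exists z.
    by case: yz; apply: (gap 11).
  by case: xz; apply: (gap 13).
by case: xy; apply: (gap 13).
Qed.

Lemma odd_prime_small_star n k : 3 <= k -> k <= 20 -> odd_prime (firecracker n k).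
Proof.
move=> k3 k20.
pose a i := (2 * (k * i)).+1.
have oa i : odd (a i) by rewrite /= mul2n odd_double.
have /fin_all_exists[c cP] (i : 'I_n) : exists j : 'I_k, 0 < j /\
    forall j' : 'I_k, j' != j -> coprime (a i + 2 * j) (a i + 2 * j').
  have [j /andP[j0 jk] h] := block_centre (oa i) k3 k20.
  by exists (Ordinal jk); split=> // j' jj'; apply: h.
have k1 : 1 < k by apply: leq_trans k3.
pose one := Ordinal k1.
(* Swapping positions 1 and [c i] moves the coprime entry to the centre; as [c i] is positive,
   position 0, the path vertex, keeps the label [a i]. *)
pose s i := tperm one (c i).
have s0 i (j : 'I_k) : j = 0 :> nat -> s i j = j.
  move=> j0; have [ci _] := cP i; rewrite tpermD //; apply/eqP=> e; move: j0; rewrite -e //.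
  by move=> ci0; rewrite ci0 in ci.
have s1 i (j : 'I_k) : j = 1 :> nat -> s i j = c i.
  by move=> j1; rewrite (_ : j = one) ?tpermL //; apply: val_inj.
apply: (@firecracker_labelling _ _ (fun i j => a i + 2 * s i j)).
- move=> i j i' j' e.
  have := ltn_ord (s i j); have := ltn_ord (s i' j') => l1 l2.
  have ii' : i = i' by apply: ord_inj; rewrite /a in e; nia.
  split=> //; rewrite -ii' in e; apply: (@perm_inj _ (s i)); apply: ord_inj.
  by rewrite /a in e; move: e; rewrite /=; lia.
- by move=> i j; rewrite oddD oa mul2n odd_double.
- by move=> i j; have := ltn_ord i; have := ltn_ord (s i j); rewrite /a; nia.
- move=> i i' j j0 ii'; rewrite !s0 // j0 !addn0.
  apply: no_common_prime_coprime => // p pp pi pi'.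
  (* A common prime divides the difference [2 * k] of the two labels, hence [2 * (k * i)], hence
     1. *)
  have pd : p %| 2 * k by rewrite -(dvdn_addr _ pi); move: pi'; rewrite /a ii'; congr (_ %| _); nia.
  move: pi; rewrite /a -addn1 mulnA dvdn_addr ?dvdn1; last exact: dvdn_mulr.
  by move=> /eqP p1; rewrite p1 in pp.
move=> i j j' j1 jj'; rewrite (s1 i j) //; apply: (proj2 (cP i)).
by rewrite -(s1 i j) // (inj_eq perm_inj).
Qed.

(** * Chebyshev's bound and few stars *)

Lemma central_binS n : n.+1 * 'C(2 * n.+1, n.+1) = 2 * (2 * n).+1 * 'C(2 * n, n).
Proof.
have f m : 'C(2 * m, m) * (m`! * m`!) = (2 * m)`!.
  by rewrite -(@bin_fact (2 * m) m) ?mul2n -?addnn ?addnK ?leq_addr.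
have := f n.+1; rewrite (_ : 2 * n.+1 = (2 * n).+2); last by lia.
rewrite !factS -(f n) => e.
have p0 : 0 < n`! * n`! * n.+1 by rewrite !muln_gt0 fact_gt0.
apply/eqP; rewrite -(eqn_pmul2r p0); apply/eqP.
by move: e; set x := 'C(_, n.+1); set y := 'C(_, n); set z := n`!; nia.
Qed.

Lemma leq_exp4_central_bin n : 0 < n -> 4 ^ n <= 2 * n * 'C(2 * n, n).
Proof.
elim: n => // -[|n] IH _; first by [].
have := IH isT; have := central_binS n.+1; rewrite (expnS 4 n.+1).
set x := 'C(_, n.+2); set y := 'C(_, n.+1); set z := 4 ^ _; nia.
Qed.

Lemma sum_leq m t : \sum_(1 <= k < m.+1) (k <= t) = minn m t.
Proof.
elim: m => [|m IH]; first by rewrite big_geq // min0n.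
by rewrite big_nat_recr //= IH; case: (leqP m.+1 t) => /=; lia.
Qed.

(** By Legendre's formula the exponent of [p] is the sum of [(2 * n) %/ p ^ k - 2 * (n %/ p ^ k)];
    each term is at most 1 and vanishes once [p ^ k] exceeds [2 * n]. *)
Lemma pfactor_central_bin p n : 0 < n -> prime p -> p ^ logn p 'C(2 * n, n) <= 2 * n.
Proof.
move=> n0 pp; have p1 := prime_gt1 pp.
have n20 : 0 < 2 * n by rewrite muln_gt0.
apply: leq_trans (trunc_logP p1 n20); rewrite leq_exp2l //.
have le : n <= 2 * n by rewrite mul2n -addnn leq_addr.
have := bin_fact le; rewrite (_ : 2 * n - n = n); last lia.
move/(congr1 (logn p)); rewrite !lognM ?muln_gt0 ?fact_gt0 ?bin_gt0 //.
rewrite !logn_fact //.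
have -> : \sum_(1 <= k < n.+1) n %/ p ^ k = \sum_(1 <= k < (2 * n).+1) n %/ p ^ k.
  rewrite [RHS](@big_cat_nat _ _ _ n.+1) //=.
  rewrite [X in _ = _ + X]big_nat_cond [X in _ = _ + X]big1 ?addn0 // => k /andP[/andP[k1 _] _].
  by apply: divn_small; apply: leq_trans k1 (ltnW (ltn_expl _ p1)).
rewrite -big_split /= => e.
have : \sum_(1 <= k < (2 * n).+1) (2 * n) %/ p ^ k <=
   \sum_(1 <= k < (2 * n).+1) ((n %/ p ^ k + n %/ p ^ k) + (k <= trunc_log p (2 * n))).
  rewrite big_nat_cond [X in _ <= X]big_nat_cond; apply: leq_sum => k /andP[/andP[k1 _] _].
  have q0 : 0 < p ^ k by rewrite expn_gt0 prime_gt0.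
  case: (leqP k (trunc_log _ _)) => [_|lt].
    rewrite /= addn1 -ltnS ltn_divLR //.
    have := divn_eq n (p ^ k); have := ltn_pmod n q0.
    set u := n %/ _; set v := n %% _; set w := p ^ k; nia.
  rewrite divn_small //; apply: leq_trans (trunc_log_ltn _ p1) _.
  by rewrite leq_exp2l.
rewrite big_split /= -e addnC leq_add2l => /leq_trans-> //.
by rewrite sum_leq geq_minr.
Qed.

(** The central binomial coefficient is a product of prime powers at most [2 * n], one per prime up
    to [2 * n]; the additional 1 in the exponent absorbs the factor [2 * n] of
    [leq_exp4_central_bin]. *)
Lemma exp4_leq_prime_count n : 0 < n ->
  4 ^ n <= (2 * n) ^ (count prime (iota 0 (2 * n).+1)).+1.
Proof.
move=> n0; apply: leq_trans (leq_exp4_central_bin n0) _.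
have b0 : 0 < 'C(2 * n, n) by rewrite bin_gt0 mul2n -addnn leq_addr.
rewrite expnS leq_mul2l; apply/orP; right.
have -> : 'C(2 * n, n) = \prod_(p <- iota 0 (2 * n).+1 | prime p) p ^ logn p 'C(2 * n, n).
  rewrite -{1}(partnT b0) (@widen_partn ('C(2 * n, n) + 2 * n)) ?leq_addr //.
  rewrite (@big_cat_nat _ _ _ (2 * n).+1) //= ?ltnS ?leq_addl //.
  rewrite [X in _ * X]big_nat_cond [X in _ * X]big1 ?muln1 => [|p /andP[/andP[lp _] _]].
    rewrite /index_iota subn0 [RHS]big_mkcond /=; apply: eq_bigr => p _.
    by case: ifP => // np; rewrite lognE np.
  case pp : (prime p); last by rewrite lognE pp.
  have [->//|l0] := posnP (logn p 'C(2 * n, n)).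
  have := pfactor_central_bin n0 pp; rewrite leqNgt => /negP[].
  by apply: leq_trans lp _; rewrite -{1}(expn1 p) leq_exp2l // prime_gt1.
rewrite -size_filter -big_filter.
have : all (fun p => prime p) [seq p <- iota 0 (2 * n).+1 | prime p] by apply: filter_all.
elim: [seq _ <- _ | _] => [|p s IH] /=; first by rewrite big_nil.
by case/andP=> pp /IH h; rewrite big_cons expnS leq_mul // pfactor_central_bin.
Qed.

Lemma count_prime_leq n : 0 < n -> count prime (iota 0 (2 * n).+2) <= n.+1.
Proof.
elim: n => // -[|n] IH _; first by [].
rewrite (_ : (2 * n.+2).+2 = (2 * n.+1).+2 + 2); last by lia.
rewrite iotaD count_cat add0n; have /= := IH isT.
have -> : prime (2 * n.+1).+2 = false.
  apply/negbTE/negP=> /even_prime[]; lia.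
by case: (prime _) => /=; lia.
Qed.

(** With [N = n * k], [4 ^ N = (2 ^ k) ^ (2 * n)] exceeds [(2 * N) ^ (2 * n)], so there are at least
    [2 * n] primes up to [2 * N]; at most [n + 1] of these are at most [2 * n + 1]. *)
Lemma many_large_primes n k : 0 < n -> 1 < k -> 2 * (n * k) < 2 ^ k ->
  exists2 c : nat -> nat, {in gtn n.-1 &, injective c} &
    forall i, i < n.-1 -> [/\ prime (c i), 2 * n + 1 < c i & c i < 2 * (n * k)].
Proof.
move=> n0; case: k => // k k1 lt.
have nk0 : 0 < n * k.+1 by rewrite muln_gt0 n0.
have cnt : 2 * n <= count prime (iota 0 (2 * (n * k.+1)).+1).
  rewrite leqNgt; apply/negP=> lt'.
  have := exp4_leq_prime_count nk0; rewrite leqNgt => /negP[].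
  apply: leq_ltn_trans (leq_pexp2l _ lt') _; first by rewrite muln_gt0.
  rewrite (_ : 4 ^ _ = (2 ^ k.+1) ^ (2 * n)) ?ltn_exp2r ?muln_gt0 //.
  by rewrite (_ : 4 = 2 ^ 2) // -!expnM; congr (_ ^ _); lia.
pose s := filter prime (iota (2 * n).+2 (2 * (n * k.+1) - (2 * n).+1)).
have szs : n.-1 <= size s.
  rewrite size_filter.
  have := cnt; have := count_prime_leq n0.
  have := count_cat prime (iota 0 (2 * n).+2) (iota (2 * n).+2 (2 * (n * k.+1) - (2 * n).+1)).
  by rewrite -iotaD (_ : (2 * n).+2 + _ = (2 * (n * k.+1)).+1); nia.
exists (nth 0 s) => [i j|i].
  rewrite !inE => li lj /eqP; rewrite nth_uniq ?(leq_trans _ szs) // => [/eqP//|].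
  by rewrite filter_uniq ?iota_uniq.
move=> li; have := mem_nth 0 (leq_trans li szs); rewrite mem_filter mem_iota.
move: (nth 0 s i) => p.
case/andP=> pp /andP[l1 l2]; split=> //; first by lia.
suff : p != 2 * (n * k.+1) by lia.
apply/eqP=> e; case: (even_prime pp); first by lia.
by rewrite e mul2n odd_double.
Qed.

Lemma card_ord_mem_leq N (s : seq nat) : #|[set y : 'I_N | (y : nat) \in s]| <= size s.
Proof.
rewrite cardE -(size_map val); apply: uniq_leq_size.
  by rewrite (map_inj_uniq val_inj) enum_uniq.
by move=> _ /mapP[y + ->]; rewrite mem_enum inE.
Qed.

Lemma coprime_consecutive_odd i : coprime (2 * i).+1 (2 * i.+1).+1.
Proof.
apply: no_common_prime_coprime => // p pp p1 p2.
have : p %| (2 * i.+1).+1 - (2 * i).+1 by apply: dvdn_sub.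
rewrite (_ : _ - _ = 2); last by lia.
rewrite dvdn_prime2 // => /eqP e; move: p1; rewrite e dvdn2 /= mul2n odd_double.
by [].
Qed.

Lemma odd_prime_few_stars n k : 1 < n -> 3 <= k -> 2 * (n * k) < 2 ^ k ->
  odd_prime (firecracker n k).
Proof.
move=> n1 k3 lt.
have [c cinj cP] := many_large_primes (ltnW n1) (ltnW k3) lt.
(* Only [n - 1] primes are at hand, so the last centre gets 1. *)
pose C i := if i < n.-1 then c i else 1.
have Cinj i j : i < n -> j < n -> C i = C j -> i = j.
  move=> li lj; rewrite /C; case: (ltnP i n.-1) => hi; case: ltnP => hj; last by lia.
  - exact: cinj.
  - by have [] := cP i hi; lia.
  - by have [] := cP j hj; lia.
have oC i : odd (C i).
  rewrite /C; case: ltnP => // hi; have [pc c1 _] := cP i hi.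
  by case: (even_prime pc) => // e; rewrite e in c1; lia.
have C1 i : C i = 1 \/ 2 * n + 1 < C i.
  by rewrite /C; case: (ltnP i n.-1) => hi; [right; case: (cP i hi)|left].
case: k k3 lt cP => [|[|[|m]]] // _ lt cP.
have Clt i : C i < 2 * (n * m.+3).
  by rewrite /C; case: (ltnP i n.-1) => hi; [case: (cP i hi) | nia].
(* An index [y] stands for the label [2 * y + 1]; indices 1 to [n] are the path labels. *)
pose used := iota 1 n ++ [seq (C i)./2 | i <- iota 0 n].
pose U : {set 'I_(n * m.+3)} := [set y : 'I_(n * m.+3) | (y : nat) \notin used].
have cardU : n * m.+1 <= #|U|.
  pose V := [set y : 'I_(n * m.+3) | (y : nat) \in used].
  have := card_ord_mem_leq (n * m.+3) used; rewrite size_cat size_map !size_iota -/V.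
  have -> : U = ~: V by apply/setP=> y; rewrite !inE.
  by have := cardsC V; rewrite card_ord; move: #|V| #|~: V| => v v'; nia.
pose R (x : 'I_n * 'I_m.+1) (y : 'I_(n * m.+3)) := (y \in U) && coprime (C x.1) (2 * y).+1.
have y0 : 'I_(n * m.+3) by exists 0; rewrite muln_gt0 ltnW.
have [X|f finj fR] := @hall_matching _ _ R y0.
  have [->|/set0Pn[[i j] Xx]] := eqVneq X set0; first by rewrite cards0.
  set N := [set y | _].
  (* If [X] meets the star with centre 1, every free label is a neighbour, and these suffice for all
     leaves. *)
  have [/existsP[[i' j'] /andP[Xx' /eqP Ci1]]|] := boolP [exists x in X, C x.1 == 1].
    have UN : U \subset N.
      apply/subsetP=> y Uy; rewrite inE; apply/existsP; exists (i', j').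
      by rewrite Xx' /R Uy Ci1 coprime1n.
    apply: leq_trans (subset_leq_card UN); apply: leq_trans cardU.
    by apply: leq_trans (max_card _) _; rewrite card_prod !card_ord.
  rewrite negb_exists => /forallP noX.
  have Xlt x : x \in X -> x.1 < n.-1.
    by move=> xX; move: (noX x); rewrite xX /C; case: ltnP.
  have hi : i < n.-1 := Xlt _ Xx.
  have [pc c1 c2] := cP i hi.
  have cardX : #|X| <= n.-1 * m.+1.
    have le := card_ord_mem_leq n (iota 0 n.-1); rewrite size_iota in le.
    have sub : X \subset setX [set x : 'I_n | (x : nat) \in iota 0 n.-1] [set: 'I_m.+1].
      by apply/subsetP=> -[a b] /Xlt /= an; rewrite !inE mem_iota an.
    apply: leq_trans (subset_leq_card sub) _.
    by rewrite cardsX cardsT card_ord leq_mul2r le orbT.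
  (* Otherwise [X] misses the [m.+1] leaves of the last star, which pays for the free multiples of
     the single prime [c i]. *)
  pose M : {set 'I_(n * m.+3)} := [set y in U | c i %| (2 * y).+1].
  have cardM : #|M| <= m.+1.
    (* Only odd multiples occur; [t] starts at 1 because [c i] itself is used, and [c i > 2 * n + 1]
       bounds it above. *)
    have := card_ord_mem_leq (n * m.+3) [seq (c i * (2 * t).+1)./2 | t <- iota 1 m.+1].
    rewrite size_map size_iota; apply: leq_trans.
    apply: subset_leq_card; apply/subsetP=> y; rewrite !in_set mem_cat negb_or 
      => /andP[/andP[_ ny] /dvdnP[q e]].
    have oq : odd q by have := congr1 odd e; rewrite /= mul2n odd_double oddM => /esym/andP[].
    apply/mapP; exists q./2; last by rewrite (_ : (2 * q./2).+1 = q); lia.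
    rewrite mem_iota; have : q != 1.
      apply: contra ny => /eqP q1; apply/mapP; exists (i : nat); first by rewrite mem_iota /= ltn_ord.
      by rewrite /C hi; lia.
    by have := ltn_ord y; nia.
  have sub : U :\: M \subset N.
    apply/subsetP=> y; rewrite !inE => /andP[nM yU]; apply/existsP; exists (i, j).
    rewrite Xx /R inE yU /C /= hi prime_coprime //.
    by move: nM; rewrite yU.
  have := subset_leq_card sub; rewrite cardsD.
  have := subset_leq_card (subsetIr U M).
  have : n * m.+1 = n.-1 * m.+1 + m.+1 by nia.
  move: cardX cardU cardM; move: #|U :&: M| #|M| #|N| #|X| #|U| => *; lia.
pose l (i : 'I_n) (j : 'I_m.+3) : nat :=
  if val j is j'.+2 then (2 * f (i, inord j')).+1 else if val j is 1 then C i else (2 * i.+1).+1.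
have fU x : (f x : nat) \notin used by have /andP[] := fR x; rewrite inE.
have fC x i : i < n -> (2 * f x).+1 <> C i.
  move=> li e; move/negP: (fU x); apply; rewrite mem_cat; apply/orP; right.
  by apply/mapP; exists i; rewrite ?mem_iota // -e; lia.
have fp x i : i < n -> (2 * f x).+1 <> (2 * i.+1).+1.
  by move=> li e; move/negP: (fU x); apply; rewrite mem_cat mem_iota; apply/orP; left; lia.
have Cp i i' : i < n -> C i <> (2 * i'.+1).+1 \/ n <= i'.
  by move=> li; case: (C1 i) => h; lia.
apply: (@firecracker_labelling _ _ l).
- move=> i j i' j'; rewrite /l.
  have := ltn_ord i; have := ltn_ord i'; have := ltn_ord j; have := ltn_ord j'.
  have ord_eq N (a b : 'I_N) v : val a = v -> val b = v -> a = b.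
    by move=> av bv; apply: val_inj; rewrite av.
  case ej: (val j) => [|[|a]]; case ej': (val j') => [|[|b]] lj' lj li' li e.
  + by split; [apply: ord_inj; lia | apply: ord_eq ej ej'].
  + by case: (Cp i' i li'); lia.
  + by case: (fp (i', inord b) i li); rewrite e.
  + by case: (Cp i i' li); lia.
  + by split; [apply: ord_inj; apply: Cinj | apply: ord_eq ej ej'].
  + by case: (fC (i', inord b) i li); rewrite e.
  + by case: (fp (i, inord a) i' li' e).
  + by case: (fC (i, inord a) i' li' e).
  + have [ab] : (i, @inord m a) = (i', @inord m b) by apply: finj; apply: ord_inj; lia.
    move/(congr1 (@nat_of_ord _)); have am : a < m.+1 by rewrite -[_ < _]/(a.+2 < m.+3) -ej.
    have bm : b < m.+1 by rewrite -[_ < _]/(b.+2 < m.+3) -ej'.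
    rewrite !inordK // => e'; split=> //.
    by apply: val_inj; rewrite ej ej' e'.
- move=> i j; rewrite /l; case: (val j) => [|[|a]]; [lia | exact: oC | lia].
- move=> i j; rewrite /l; have := ltn_ord i; case: (val j) => [|[|a]] //.
    by nia.
  by have := ltn_ord (f (i, inord a)); lia.
- move=> i i' j j0 ii'; rewrite /l /= j0 ii'; exact: coprime_consecutive_odd.
move=> i j j' j1 jj'; rewrite /l /= j1.
case ej': (nat_of_ord j') => [|[|b]].
- rewrite /C; case: (ltnP i n.-1) => hi; last exact: coprime1n.
  have [pc c1 _] := cP i hi; rewrite prime_coprime //; apply/negP=> /dvdn_leq; have := ltn_ord i; lia.
- by case/eqP: jj'; apply: ord_inj; rewrite ej' j1.
by have /andP[] := fR (i, inord b).
Qed.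

(** * A sieve over arithmetic progressions *)

Import Order.TTheory GRing.Theory Num.Theory.
Local Open Scope ring_scope.

Lemma ap_dvd_class q a D : (1 < q)%N -> coprime q D ->
  exists2 i0, (i0 < q)%N & forall i, (q %| a + D * i)%N = (i %% q == i0)%N.
Proof.
move=> q1 coqD; have q0 : (0 < q)%N by apply: ltnW.
have D0 : (0 < D)%N by case: D coqD => //; rewrite /coprime gcdn0 => /eqP e; rewrite e in q1.
have [u v uv _] := egcdnP q D0; rewrite gcdnC (eqP coqD) in uv.
(* Modulo [q], [u] inverts [D] and [q.-1] is -1, so this is the root of [a + D * i]. *)
exists ((u * (a * q.-1)) %% q)%N; first by rewrite ltn_mod.
move=> i; apply/idP/eqP => [dv|e].
  have : (u * (a + D * i) = u * (a + a * q.-1) %[mod q])%N.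
    rewrite -mulnS prednK // !mulnA modnMl; apply/eqP; exact: dvdn_mull.
  rewrite !mulnDr => /eqP; rewrite eqn_modDl => /eqP <-.
  by rewrite mulnA uv mulnDl mul1n mulnAC modnMDl.
have : (D * i = D * (u * (a * q.-1)) %[mod q])%N.
  by rewrite -modnMmr e modnMmr.
rewrite mulnA (mulnC D u) uv mulnDl mul1n mulnAC modnMDl => e2.
by rewrite /dvdn -modnDmr e2 modnDmr -mulnS prednK // modnMl.
Qed.

Section Sieve.
Variable R : realFieldType.

(** The upper limit is the ceiling of [(m - i0) / q], the number of [i < m] congruent to [i0]. *)
Lemma ap_multiples q i0 (F : nat -> R) m : (i0 < q)%N ->
  \sum_(i < m) (i %% q == i0)%N%:R * F i =
  \sum_(t < ((m + (q.-1 - i0)) %/ q)%N) F (i0 + q * t)%N.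
Proof.
move=> iq; have q0 : (0 < q)%N by apply: leq_ltn_trans iq.
elim: m => [|m IH]; first by rewrite add0n divn_small ?big_ord0 //; lia.
rewrite big_ord_recr /= IH.
have em := divn_eq m q; have lm : (m %% q < q)%N by rewrite ltn_mod.
set d := (m %/ q)%N in em *; set r := (m %% q)%N in em lm *.
have divE t : (t < q)%N -> ((d * q + t) %/ q = d)%N.
  by move=> tq; rewrite divnMDl // divn_small ?addn0.
have divE' t : (t < q)%N -> ((d * q + q + t) %/ q = d.+1)%N.
  by move=> tq; rewrite addnAC divnDr // divE // divnn q0 addn1.
have [e|ne] := eqVneq r i0.
  rewrite (_ : m.+1 + _ = d * q + q + 0)%N ?divE' //; last by lia.
  rewrite (_ : m + _ = d * q + q.-1)%N ?divE //; [|lia..].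
  by rewrite big_ord_recr /= mul1r {1}em e addnC mulnC.
rewrite mul0r addr0.
suff -> : ((m.+1 + (q.-1 - i0)) %/ q = (m + (q.-1 - i0)) %/ q)%N by [].
have [lt|ge] := ltnP r i0.
  rewrite (_ : m.+1 + _ = d * q + (r.+1 + (q.-1 - i0)))%N ?divE; [|lia..].
  by rewrite (_ : m + _ = d * q + (r + (q.-1 - i0)))%N ?divE; lia.
rewrite (_ : m.+1 + _ = d * q + q + (r - i0))%N ?divE'; [|lia..].
by rewrite (_ : m + _ = d * q + q + (r - i0).-1)%N ?divE'; lia.
Qed.

Lemma ap_multiples_count q i0 m (m' := ((m + (q.-1 - i0)) %/ q)%N) : (i0 < q)%N ->
  `|m'%:R - m%:R / q%:R| <= 1 :> R.
Proof.
move=> iq; have q0 : (0 < q)%N by apply: leq_ltn_trans iq.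
have q0' : 0 < q%:R :> R by rewrite ltr0n.
have : (m' * q <= m + q /\ m <= m' * q + q)%N.
  have := divn_eq (m + (q.-1 - i0)) q; have := ltn_pmod (m + (q.-1 - i0)) q0.
  by rewrite -/m'; move: (_ %% _)%N => r; nia.
rewrite -!(ler_nat R) !natrD !natrM => -[h1 h2].
have h3 : m%:R / q%:R <= m'%:R + 1 :> R by rewrite ler_pdivrMr // mulrDl mul1r.
have h4 : m'%:R - 1 <= m%:R / q%:R :> R.
  by rewrite ler_pdivlMr // mulrBl mul1r lerBlDr.
by rewrite ler_norml; lra.
Qed.

Definition weight (h : nat -> R) (P : seq nat) (x : nat) : R :=
  \prod_(q <- P) (1 + h q * (q %| x)%:R).

(** For distinct primes in [P] this is the average of [weight h P] over a full period, by the
    Chinese remainder theorem. *)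
Definition mean (h : nat -> R) (P : seq nat) : R :=
  \prod_(q <- P) (1 + h q / q%:R).

(* [h q = -1] gives Legendre's sieve, and [h q = 1 / (q - 1)] the mean value of
   [x / totient x]. *)
Lemma weight_ap h K P : 0 <= K ->
  (forall s, subseq s P -> `|mean h s| <= K) -> uniq P -> all prime P ->
  forall a D m, all (coprime D) P ->
  `|\sum_(i < m) weight h P (a + D * i) - m%:R * mean h P|
    <= K * (\prod_(q <- P) (1 + `|h q|) - 1).
Proof.
move=> K0; elim: P => [|q P IH] sK uP pP a D m coD.
  rewrite /mean !big_nil subrr mulr0 mulr1 (eq_bigr (fun=> 1)) => [|i _].
    by rewrite sumr_const card_ord subrr normr0.
  by rewrite /weight big_nil.
have /= /andP[qP uP'] := uP; have /= /andP[pq pP'] := pP; have /= /andP[coDq coDP] := coD.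
have {}IH := IH (fun s sP => sK s (subseq_trans sP (subseq_cons _ _))) uP' pP'.
have coqD : coprime q D by rewrite coprime_sym.
have [i0 i0q i0P] := ap_dvd_class a (prime_gt1 pq) coqD.
have q0 : q%:R != 0 :> R by rewrite pnatr_eq0 -lt0n prime_gt0.
rewrite /mean !big_cons -/(mean h P).
set m' := ((m + (q.-1 - i0)) %/ q)%N.
(* The terms divisible by [q] form a progression of difference [D * q], to which the induction
   hypothesis applies as well. *)
have -> : \sum_(i < m) weight h (q :: P) (a + D * i) =
   \sum_(i < m) weight h P (a + D * i) +
   h q * \sum_(t < m') weight h P ((a + D * i0) + (D * q) * t).
  transitivity (\sum_(i < m) weight h P (a + D * i) +
     h q * \sum_(i < m) (i %% q == i0)%N%:R * weight h P (a + D * i)).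
    rewrite mulr_sumr -big_split; apply: eq_bigr => i _ /=.
    by rewrite /weight big_cons -i0P; ring.
  rewrite (ap_multiples (fun i => weight h P (a + D * i)) m i0q).
  by congr (_ + _ * _); apply: eq_bigr => t _; rewrite mulnDr addnA mulnA.
have h1 := IH a D m coDP.
have coDq' : all (coprime (D * q)) P.
  apply/allP=> p pP0; have pp : prime p := allP pP' p pP0.
  rewrite coprimeMl (allP coDP) // prime_coprime // dvdn_prime2 //.
  by apply: contra qP => /eqP->.
have h2 := IH (a + D * i0)%N (D * q)%N m' coDq'.
have h3 := ap_multiples_count m i0q; rewrite -/m' in h3.
have h4 := sK P (subseq_cons _ _).
move: h1 h2 h3 h4; set W := \sum_(i < m) _; set W' := \sum_(t < m') _.
set A := mean h P; set Pi := \prod_(_ <- _) _ => h1 h2 h3 h4.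
(* With [E = K * (Pi - 1)], the error is at most [E + |h q| * (E + K)], which equals
   [K * (Pi * (1 + |h q|) - 1)]. *)
have -> : W + h q * W' - m%:R * ((1 + h q / q%:R) * A) =
   (W - m%:R * A) + h q * ((W' - m'%:R * A) + (m'%:R - m%:R / q%:R) * A) by field.
apply: le_trans (ler_normD _ _) _; rewrite normrM.
have h5 : `|W' - m'%:R * A + (m'%:R - m%:R / q%:R) * A| <= K * (Pi - 1) + K.
  apply: le_trans (ler_normD _ _) _; rewrite normrM; apply: lerD => //.
  by rewrite -[K]mul1r; apply: ler_pM.
have h6 := ler_wpM2l (normr_ge0 (h q)) h5.
by move: h6 h1; set x := `|h q| * _; nra.
Qed.

End Sieve.

(** * Products over odd numbers *)

Section ProductBounds.
Variable R : realFieldType.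

(** No factor is below 1, so passing from a set of primes to all odd numbers from 3 to [2 * J + 1]
    can only enlarge the product. *)
Lemma prod_le_odds (f : nat -> R) (s : seq nat) J :
  (forall q, 1 <= f q) -> uniq s ->
  (forall q, q \in s -> exists2 j, (j < J)%N & q = (2 * j).+3) ->
  \prod_(q <- s) f q <= \prod_(j < J) f (2 * j).+3.
Proof.
move=> f1 us sJ; pose t := [seq (2 * j).+3 | j <- iota 0 J].
have f0 q : 0 <= f q by apply: le_trans (f1 q).
have -> : \prod_(j < J) f (2 * j).+3 = \prod_(q <- t) f q.
  by rewrite -(big_mkord xpredT (fun j => f (2 * j).+3)) /index_iota subn0 big_map.
have ut : uniq t by rewrite map_inj_uniq ?iota_uniq // => i j; lia.
have st : {subset s <= t}.
  by move=> q /sJ[j jJ ->]; apply/mapP; exists j; rewrite ?mem_iota.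
have p1 : perm_eq [seq q <- t | q \in s] s.
  apply: uniq_perm; rewrite ?filter_uniq // => q.
  by rewrite mem_filter; case: (boolP (q \in s)) => // /st ->.
rewrite -(perm_big _ p1) /= big_filter big_mkcond /=.
apply: ler_prod => q _; case: ifP => _; first by rewrite f0 lexx.
by rewrite ler01 f1.
Qed.

(* The factor [(4J+13)/(4J+14)] makes the bound telescope. *)
Lemma prod_odds_pred_le J :
  \prod_(j < J) (1 + ((2 * j).+2%:R)^-1 / (2 * j).+3%:R) <= 34 / 25 :> R.
Proof.
pose F m : R := \prod_(j < m) (1 + ((2 * j).+2%:R)^-1 / (2 * j).+3%:R); rewrite -/(F J).
have FS m : F m.+1 = F m * (1 + ((2 * m).+2%:R)^-1 / (2 * m).+3%:R).
  by rewrite /F big_ord_recr.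
have F3 m : F m.+3 <= 34 / 25 * ((4 * m%:R + 13) / (4 * m%:R + 14)).
  elim: m => [|m IH].
    by rewrite !FS /F big_ord0 -[(2 * 0)%N]/0%N -[(2 * 1)%N]/2%N -[(2 * 2)%N]/4%N mulr0 !add0r; lra.
  rewrite FS; have m0 : 0 <= m%:R :> R by apply: ler0n.
  have -> : (2 * m.+3).+2%:R = 2 * m%:R + 8 :> R by rewrite -natr1 -natr1 natrM -!natr1; ring.
  have -> : (2 * m.+3).+3%:R = 2 * m%:R + 9 :> R by rewrite -natr1 -natr1 -natr1 natrM -!natr1; ring.
  rewrite -[m.+1%:R]natr1.
  have p0 : 0 <= 1 + (2 * m%:R + 8)^-1 / (2 * m%:R + 9) :> R.
    by rewrite addr_ge0 // mulr_ge0 // invr_ge0; lra.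
  apply: le_trans (ler_wpM2r p0 IH) _.
  move: m%:R m0 => x x0; rewrite -[X in X <= _]mulrA ler_pM2l; last by lra.
  rewrite -subr_ge0.
  have -> : (4 * (x + 1) + 13) / (4 * (x + 1) + 14) - (4 * x + 13) / (4 * x + 14) *
     (1 + (2 * x + 8)^-1 / (2 * x + 9)) =
     (6 * x + 27) * 2 / ((4 * x + 18) * (4 * x + 14) * (2 * x + 8) * (2 * x + 9)) :> R.
    field; lra.
  by rewrite divr_ge0 // ?mulr_ge0 //; lra.
have mono i : F i <= F i.+1.
  rewrite FS ler_peMr //; first by apply: prodr_ge0 => j _; rewrite addr_ge0 // mulr_ge0 // invr_ge0.
  by rewrite lerDl mulr_ge0 // invr_ge0.
(* [F3] needs at least three factors; monotonicity carries its bound to every [J]. *)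
apply: le_trans (mono J) (le_trans (mono _) (le_trans (mono _) (le_trans (F3 J) _))).
have m0 : 0 <= J%:R :> R by apply: ler0n.
by rewrite ler_piMr; [|lra|rewrite ler_pdivrMr; lra].
Qed.

(** Since [(2j+1)(2j+3) <= (2j+2)^2], the square of each factor is at most [(2j+3)/(2j+1)], and
    these ratios telescope. *)
Lemma prod_odds_ratio_le J :
  (\prod_(j < J) (1 + ((2 * j).+2%:R)^-1)) ^+ 2 <= (2 * J).+1%:R :> R.
Proof.
elim: J => [|J IH]; first by rewrite big_ord0 expr1n.
rewrite big_ord_recr /= exprMn.
have m0 : 0 <= J%:R :> R by apply: ler0n.
have e1 : (2 * J).+1%:R = 2 * J%:R + 1 :> R by rewrite -natr1 natrM.
have e2 : (2 * J).+2%:R = 2 * J%:R + 2 :> R by rewrite -natr1 e1; ring.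
have e3 : (2 * J.+1).+1%:R = 2 * J%:R + 3 :> R by rewrite -natr1 natrM -natr1; ring.
apply: le_trans (ler_wpM2r (sqr_ge0 _) IH) _; rewrite e1 e2 e3.
move: J%:R m0 => x x0; rewrite -subr_ge0.
have -> : 2 * x + 3 - (2 * x + 1) * (1 + (2 * x + 2)^-1) ^+ 2 =
   (2 * x + 3) / (2 * x + 2) ^+ 2 :> R by field; lra.
by rewrite divr_ge0 ?sqr_ge0 //; lra.
Qed.

End ProductBounds.

Lemma prod_primes_leq x : (0 < x)%N -> (\prod_(p <- primes x) p <= x)%N.
Proof.
move=> x0; rewrite {2}(prod_prime_decomp x0) prime_decompE big_map /=.
rewrite big_seq [X in (_ <= X)%N]big_seq; apply: leq_prod => p px.
by rewrite -{1}(expn1 p) leq_pexp2l ?logn_gt0 //; move: px; rewrite mem_primes => /andP[/prime_gt0].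
Qed.

Lemma primes_odd x q : odd x -> q \in primes x -> exists2 j, (j < x)%N & q = (2 * j).+3.
Proof.
move=> ox; rewrite mem_primes => /and3P[pq x0 qx].
have oq := dvdn_odd qx ox; have := dvdn_leq x0 qx; have := prime_gt1 pq.
by exists (q - 3)./2; lia.
Qed.

(** Replacing a prime [q] by 9 costs the factor [9/q], above 1 only for 3, 5, 7: in all at most
    729/105 < 7. This controls the square of the sieve error [3 ^+ size (primes x)]. *)
Lemma exp9_omega_ler (R : realFieldType) x : odd x -> 9 ^+ size (primes x) <= 7 * x%:R :> R.
Proof.
move=> ox; have x0 : (0 < x)%N by case: x ox.
pose f q : R := if (2 < q < 9)%N then 9 / q%:R else 1.
have f1 q : 1 <= f q.
  rewrite /f; case: ifP => // /andP[q2 q9].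
  have q0 : 0 < q%:R :> R by rewrite ltr0n; lia.
  by rewrite ler_pdivlMr // mul1r ler_nat ltnW.
have f9 q : (2 < q)%N -> 9 <= f q * q%:R.
  move=> q2; rewrite /f q2 /=; case: ltnP => h; last by rewrite mul1r ler_nat.
  by rewrite divfK // pnatr_eq0; lia.
have le1 : 9 ^+ size (primes x) <= \prod_(q <- primes x) f q * (\prod_(q <- primes x) q)%:R.
  have : all (leq 3) (primes x) by apply/allP=> q /(primes_odd ox)[j _ ->].
  elim: (primes x) => [|q s IH] /=; first by rewrite !big_nil mulr1.
  case/andP=> q3 /IH h; rewrite !big_cons exprS natrM mulrACA.
  by apply: ler_pM => //; [apply: exprn_ge0 | apply: f9].
have le2 : \prod_(q <- primes x) f q <= 729 / 105.
  have fodds m : \prod_(j < m.+3) f (2 * j).+3 = 729 / 105.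
    elim: m => [|m IH]; first by rewrite !big_ord_recr big_ord0 /= /f
      -[(2 * 0)%N]/0%N -[(2 * 1)%N]/2%N -[(2 * 2)%N]/4%N /=; lra.
    by rewrite big_ord_recr /= IH /f (_ : (_ < 9)%N = false) ?andbF ?mulr1 //; lia.
  have := @prod_le_odds _ f (primes x) x.+3 f1 (primes_uniq x); rewrite fodds.
  by apply=> q /(primes_odd ox)[j jx ->]; exists j => //; lia.
apply: le_trans le1 _.
have := prod_primes_leq x0; rewrite -(ler_nat R) => le3.
have le4 : 0 <= (\prod_(q <- primes x) q)%:R :> R by apply: ler0n.
by apply: le_trans (ler_wpM2r le4 le2) _; lra.
Qed.

(** * The ratio of x to its totient, and counts of coprime terms *)

Section Psi.
Variable R : realFieldType.

Definition psi_fac (q : nat) : R := q.-1%:R^-1.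
Definition odd_primes_below X : seq nat := [seq p <- iota 3 (X - 3) | prime p].

(* For odd [x < X] this is [x / totient x]. *)
Definition psi X x : R := weight psi_fac (odd_primes_below X) x.

Lemma psi_fac_ge0 q : 0 <= psi_fac q.
Proof. by rewrite /psi_fac invr_ge0. Qed.

Lemma odd_primes_belowP X q : q \in odd_primes_below X ->
  exists2 j, (j < X)%N & q = (2 * j).+3.
Proof.
rewrite mem_filter mem_iota => /and3P[pq q3 qX]; exists (q - 3)./2; first by lia.
by case: (even_prime pq); lia.
Qed.

Lemma odd_primes_below_double N q : q \in odd_primes_below (2 * N) ->
  exists2 j, (j < N)%N & q = (2 * j).+3.
Proof.
move=> h; have [j _ e] := odd_primes_belowP h; exists j => //.
by move: h; rewrite mem_filter mem_iota; lia.
Qed.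

Lemma psi_ge1 X x : 1 <= psi X x.
Proof.
rewrite /psi /weight; elim: (odd_primes_below X) => [|q s IH]; first by rewrite big_nil.
rewrite big_cons; apply: le_trans IH _; rewrite ler_peMl //.
  by apply: prodr_ge0 => p _; rewrite addr_ge0 // mulr_ge0 // psi_fac_ge0.
by rewrite lerDl mulr_ge0 // psi_fac_ge0.
Qed.

Lemma mean_psi_le X s : subseq s (odd_primes_below X) ->
  0 <= mean psi_fac s <= 34 / 25.
Proof.
move=> sP; apply/andP; split.
  by apply: prodr_ge0 => p _; rewrite addr_ge0 // divr_ge0 // psi_fac_ge0.
apply: le_trans (prod_odds_pred_le R X); rewrite /mean.
apply: (@prod_le_odds R (fun q => 1 + psi_fac q / q%:R)).
- by move=> q; rewrite lerDl divr_ge0 // psi_fac_ge0.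
- by apply: subseq_uniq sP _; rewrite filter_uniq ?iota_uniq.
by move=> q /(mem_subseq sP)/odd_primes_belowP.
Qed.

(** [L] stands in for the square root of [2 * N + 1], which bounds the product of the [1 + 1/(q-1)]
    and hence the error in [weight_ap]; 9/25 is 34/25 - 1. *)
Lemma sum_psi_le N a m (L : R) : 0 <= L -> (2 * N).+1%:R <= L ^+ 2 ->
  \sum_(i < m) (psi (2 * N) (a + 2 * i) - 1) <= 9 / 25 * m%:R + 34 / 25 * L.
Proof.
move=> L0 NL; set P := odd_primes_below (2 * N).
have oP q : q \in P -> odd q by move/odd_primes_belowP=> [j _ ->]; rewrite /= mul2n odd_double.
have uP : uniq P by rewrite filter_uniq ?iota_uniq.
have pP : all prime P by apply: filter_all.
have c2 : all (coprime 2) P by apply/allP=> q /oP; rewrite coprime2n.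
have sK s : subseq s P -> `|mean psi_fac s| <= 34 / 25.
  by move=> /mean_psi_le/andP[h0 h1]; rewrite ger0_norm.
have K0 : 0 <= 34 / 25 :> R by lra.
have := @weight_ap R psi_fac (34 / 25) P K0 sK uP pP a 2 m c2.
set W := \sum_(i < m) _; rewrite ler_norml => /andP[_].
have -> : \sum_(i < m) (psi (2 * N) (a + 2 * i) - 1) = W - m%:R.
  by rewrite /W sumrB sumr_const card_ord.
have Lam : \prod_(q <- P) (1 + `|psi_fac q|) <= L.
  apply: (@le_trans _ _ (\prod_(j < N) (1 + ((2 * j).+2%:R)^-1))).
    rewrite (eq_bigr (fun q => 1 + psi_fac q)) => [|q _]; last by rewrite ger0_norm ?psi_fac_ge0.
    apply: (@prod_le_odds R (fun q => 1 + psi_fac q)) => // [q|q].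
      by rewrite lerDl psi_fac_ge0.
    exact: odd_primes_below_double.
  rewrite -(@ler_pXn2r _ 2) ?nnegrE //; last first.
    by apply: prodr_ge0 => j _; rewrite addr_ge0 // invr_ge0.
  exact: le_trans (prod_odds_ratio_le R N) NL.
have /andP[_ A1] := mean_psi_le (subseq_refl P).
have := ler_wpM2l (ler0n _ m) A1; move: (\prod_(_ <- _) _) Lam => Pi; lra.
Qed.

Lemma weight_coprime x c : (0 < x)%N -> (0 < c)%N ->
  weight (fun=> -1) (primes x) c = (coprime x c)%:R :> R.
Proof.
move=> x0 c0; rewrite coprime_sym coprime_has_primes // -all_predC.
have : all (fun p => (p \in primes c) == (p %| c)%N) (primes x).
  by apply/allP=> p; rewrite !mem_primes c0 => /and3P[-> _ _].
rewrite /weight; elim: (primes x) => [|p s IH] /=; first by rewrite big_nil.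
case/andP=> /eqP e /IH h; rewrite big_cons h e mulN1r.
by case: (p %| c)%N => /=; rewrite ?subrr ?mul0r ?subr0 ?mul1r.
Qed.

Lemma psiE X x : odd x -> (x < X)%N ->
  psi X x = \prod_(q <- primes x) (1 + psi_fac q).
Proof.
move=> ox xX; rewrite /psi /weight.
have p1 : perm_eq (primes x) [seq q <- odd_primes_below X | (q %| x)%N].
  apply: uniq_perm; rewrite ?primes_uniq ?filter_uniq ?iota_uniq // => q.
  rewrite !mem_filter mem_iota mem_primes.
  have x0 : (0 < x)%N by case: x ox {xX}.
  case: (boolP (prime q)) => [pq|_]; last by rewrite andbF.
  rewrite x0 /=; case: (boolP (q %| x)%N) => //= qx; apply/esym.
  by have := dvdn_leq x0 qx; have := prime_gt1 pq; have := dvdn_odd qx ox; lia.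
rewrite (perm_big _ p1) /= big_filter [RHS]big_mkcond /=; apply: eq_bigr => q _.
by case: (q %| x)%N; rewrite ?mulr1 // mulr0 addr0.
Qed.

(** Legendre's sieve bounds the count below by [m] times the density, less [2 ^+ w]. Multiplying by
    [psi X x], the inverse of the density, at most turns [2 ^+ w] into [3 ^+ w], as [2q/(q-1) <= 3]
    for [q >= 3]. *)
Lemma coprime_count_psi X x b m : odd x -> (x < X)%N -> odd b ->
  m%:R - 3 ^+ size (primes x) <=
  psi X x * \sum_(i < m) (coprime x (b + 2 * i))%:R.
Proof.
move=> ox xX ob; rewrite psiE //.
have x0 : (0 < x)%N by case: x ox {xX}.
have q2 q : q \in primes x -> (2 < q)%N by move/(primes_odd ox)=> [j _ ->].
have f01 q : (2 < q)%N -> 0 <= 1 + -1 / q%:R :> R /\ 1 + -1 / q%:R <= 1 :> R.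
  move=> h; have q0 : 0 < q%:R :> R by rewrite ltr0n; lia.
  have h0 : 0 < (q%:R)^-1 :> R by rewrite invr_gt0.
  have h1 : (q%:R)^-1 <= 1 :> R by rewrite invf_le1 // ler1n; lia.
  by rewrite mulN1r; lra.
have all2 : all (leq 3) (primes x) by apply/allP.
have sK s : subseq s (primes x) -> `|mean (fun=> -1) s| <= 1 :> R.
  move=> /mem_subseq sx; have {}sx : all (leq 3) s by apply/allP=> q /sx/q2.
  rewrite /mean normr_prod; elim: s sx => [|q s IH]; first by rewrite big_nil.
  move=> /= /andP[/f01[h0 h1] /IH h]; rewrite big_cons (ger0_norm h0).
  by rewrite -[leRHS]mulr1; apply: ler_pM => //; apply: prodr_ge0.
have pP : all prime (primes x) by apply/allP=> q; rewrite mem_primes => /andP[].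
have c2 : all (coprime 2) (primes x).
  by apply/allP=> q /(primes_odd ox)[j _ ->]; rewrite coprime2n /= mul2n odd_double.
have := @weight_ap R (fun=> -1) 1 _ ler01 sK (primes_uniq x) pP b 2 m c2.
rewrite (eq_bigr (fun i : 'I_m => (coprime x (b + 2 * i))%:R)) => [|i _]; last first.
  by rewrite weight_coprime // addn_gt0; case: b ob.
rewrite ler_norml mul1r => /andP[+ _].
rewrite normrN1 big_const_seq count_predT iter_mulr_1.
set M := mean _ _; set Psi := \prod_(_ <- _) _; set C := \sum_(i < m) _; set w := size _.
have PM : Psi * M = 1.
  rewrite /Psi /M /mean -big_split big_seq big1 // => q /q2 h /=.
  rewrite /psi_fac -[in _ / _](@prednK q) ?(ltnW (ltnW h)) // -natr1.
  have : 0 < q.-1%:R :> R by rewrite ltr0n; lia.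
  by move: (q.-1%:R : R) => y y0; field; lra.
have Psi0 : 0 <= Psi by apply: prodr_ge0 => q _; rewrite addr_ge0 // psi_fac_ge0.
have P3 : Psi * 2 ^+ w <= 3 ^+ w.
  rewrite /Psi /w; elim: (primes x) all2 => [|q s IH] /=; first by rewrite big_nil mulr1.
  case/andP=> q3 /IH h; rewrite big_cons !exprS mulrACA; apply: ler_pM => //.
  - by rewrite mulr_ge0 // addr_ge0 // psi_fac_ge0.
  - by rewrite mulr_ge0 ?exprn_ge0 // prodr_ge0 // => p _; rewrite addr_ge0 // psi_fac_ge0.
  have : psi_fac q <= 2^-1 by rewrite /psi_fac lef_pV2 ?posrE ?ltr0n // ?ler_nat; lia.
  lra.
rewrite -[1 + 1]/(2%:R) => h; have h' : m%:R * M - 2 ^+ w <= C by lra.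
have := ler_wpM2l Psi0 h'; rewrite mulrBr mulrCA PM mulr1.
by apply: le_trans; rewrite lerD2l lerN2.
Qed.

End Psi.

(** * Many stars *)

(** Each [x] in [S] has [11n/12 - u <= u (psi x - 1)], with left side at least [5n/12]. Summed over
    [S], the right side is at most [u] times [(9/25 + 34/825) n], which is below [5un/12]. *)
Lemma card_le_coprime_nbhd n k a b (S U : {set 'I_n}) :
  (0 < k)%N -> (2300 * k <= n)%N -> odd a -> odd b ->
  (a + 2 * n <= 2 * (n * k) + 1)%N ->
  (forall i j : 'I_n, i \in S -> coprime (a + 2 * i) (b + 2 * j) -> j \in U) ->
  (2 * #|U| <= n)%N -> (#|S| <= #|U|)%N.
Proof.
move=> k0 nk oa ob aX SU U2.
have aux (R : realFieldType) : #|S|%:R <= #|U|%:R :> R; last by rewrite -(ler_nat rat) aux.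
pose X := (2 * (n * k))%N; set u : R := #|U|%:R.
have nR : 2300 * k%:R <= n%:R :> R by rewrite -(ler_nat R) natrM in nk.
have k1 : 1 <= k%:R :> R by rewrite ler1n.
have u2 : 2 * u <= n%:R by rewrite -(ler_nat R) natrM in U2.
have xX (i : 'I_n) : (a + 2 * i < X)%N by rewrite /X; have := ltn_ord i; lia.
have ox (i : 'I_n) : odd (a + 2 * i) by rewrite oddD oa mul2n odd_double.
have big i : i \in S -> 11 / 12 * n%:R <= u * psi R X (a + 2 * i).
  move=> iS; have := coprime_count_psi R n (ox i) (xX i) ob.
  have P0 : 0 <= psi R X (a + 2 * i) by apply: le_trans (psi_ge1 _ _ _).
  have cu : \sum_(j < n) (coprime (a + 2 * i) (b + 2 * j))%:R <= u.
    rewrite /u -sum1_card natr_sum [leRHS]big_mkcond /=; apply: ler_sum => j _.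
    by case: ifP => [_|/negP h]; [case: coprime | case: (boolP (coprime _ _)) => // /(SU i j iS)].
  (* Squared, this follows from [14nk <= n^2/144], that is [n >= 2016k]. *)
  have w3 : 3 ^+ size (primes (a + 2 * i)) <= n%:R / 12 :> R.
    rewrite -(@ler_pXn2r _ 2) ?nnegrE ?exprn_ge0 ?divr_ge0 //.
    rewrite exprAC -natrX; apply: le_trans (exp9_omega_ler R (ox i)) _.
    have : (a + 2 * i)%:R <= 2 * (n%:R * k%:R) :> R.
      by rewrite -!natrM ler_nat ltnW // (xX i).
    move: n%:R k%:R nR k1 => N K *; nra.
  move=> h; have := ler_wpM2l P0 cu; lra.
have L0 : 0 <= n%:R / 33 :> R by apply: divr_ge0.
(* This asks for [n^2 >= 1089 (2nk + 1)], slightly more than [n >= 2178k]; hence the constant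
   2300. *)
have NL : (2 * (n * k)).+1%:R <= (n%:R / 33) ^+ 2 :> R.
  rewrite -natr1 !natrM; move: n%:R k%:R nR k1 => N K *; nra.
have tot := sum_psi_le a n L0 NL.
have part : \sum_(i in S) (psi R X (a + 2 * i) - 1) <= \sum_(i < n) (psi R X (a + 2 * i) - 1).
  rewrite big_mkcond /=; apply: ler_sum => i _; case: ifP => // _.
  by rewrite subr_ge0 psi_ge1.
have u0 : 0 <= u by apply: ler0n.
have n0 : 0 < n%:R :> R by lra.
have low : #|S|%:R * (11 / 12 * n%:R - u) <= u * \sum_(i in S) (psi R X (a + 2 * i) - 1).
  rewrite mulr_sumr mulr_natl -sumr_const; apply: ler_sum => i iS.
  by rewrite mulrBr mulr1 lerB // big.
have := ler_wpM2l u0 (le_trans part tot).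
move: low; set T := \sum_(i in S) _; set s := #|S|%:R => low up.
have s0 : 0 <= s by apply: ler0n.
have gap : 5 / 12 * n%:R <= 11 / 12 * n%:R - u by lra.
have := ler_wpM2l s0 gap => h.
have e : s * (5 / 12 * n%:R) <= u * (5 / 12 * n%:R).
  apply: le_trans h (le_trans low (le_trans up _)); apply: ler_wpM2l => //; lra.
by rewrite ler_pM2r in e => //; lra.
Qed.

Lemma coprime_matching n k a b :
  (0 < k)%N -> (2300 * k <= n)%N -> odd a -> odd b ->
  (a + 2 * n <= 2 * (n * k) + 1)%N -> (b + 2 * n <= 2 * (n * k) + 1)%N ->
  exists s : {perm 'I_n}, forall i : 'I_n, coprime (a + 2 * i) (b + 2 * s i).
Proof.
move=> k0 nk oa ob aX bX.
have n0 : (0 < n)%N by apply: leq_trans nk; rewrite muln_gt0.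
pose R (i j : 'I_n) := coprime (a + 2 * i) (b + 2 * j).
have [S|f finj fR] := @hall_matching _ _ R (Ordinal n0); last first.
  by exists (perm finj) => i; rewrite permE; apply: fR.
set U := [set j | _].
have SU (i j : 'I_n) : i \in S -> coprime (a + 2 * i) (b + 2 * j) -> j \in U.
  by move=> iS ij; rewrite inE; apply/existsP; exists i; rewrite iS.
have [U2|U2] := leqP (2 * #|U|) n.
  exact: card_le_coprime_nbhd k0 nk oa ob aX SU U2.
(* No element of [~: U] has a coprime partner in [S], so [~: U] and [~: S] can replace [S] and [U];
   if [#|U| < #|S|], then [~: S] has fewer than [n/2] elements. *)
rewrite leqNgt; apply/negP=> lt.
have cS := cardsC S; have cU := cardsC U; rewrite card_ord in cS cU.
have := @card_le_coprime_nbhd n k b a (~: U) (~: S) k0 nk ob oa bX.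
suff h : forall i j : 'I_n, i \in ~: U -> coprime (b + 2 * i) (a + 2 * j) -> j \in ~: S.
  by move=> /(_ h); move: #|~: S| #|~: U| #|S| #|U| cS cU lt U2 => *; lia.
move=> i j; rewrite in_setC => iU ij; rewrite in_setC; apply: contra iU => jS.
by apply: (SU j) => //; rewrite coprime_sym.
Qed.

Lemma odd_prime_many_stars n k : (1 < k)%N -> (2300 * k <= n)%N ->
  odd_prime (firecracker n k).
Proof.
move=> k1 nk; have k0 := ltnW k1; pose a j := (2 * (n * j)).+1.
have oa j : odd (a j) by rewrite /= mul2n odd_double.
have aX (j : 'I_k) : (a j + 2 * n <= 2 * (n * k) + 1)%N.
  have : (n * j.+1 <= n * k)%N by rewrite leq_mul2l ltn_ord orbT.
  by rewrite /a mulnS; lia.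
pose j0 := Ordinal k0; pose j1 := Ordinal k1.
have M (i j : 'I_k) := coprime_matching k0 nk (oa i) (oa j) (aX i) (aX j).
have [s sP] := M j0 j1.
have /fin_all_exists[t tP] (j : 'I_k) : exists t : {perm 'I_n},
    forall i : 'I_n, coprime (a j1 + 2 * i) (a j + 2 * t i) := M j1 j.
(* The path keeps its natural order; centres follow it through [s], and each leaf layer follows the
   centres through [t j]. *)
pose p (i : 'I_n) (j : 'I_k) :=
  if j == j0 then i else if j == j1 then s i else t j (s i).
have pinj j : injective (p^~ j).
  move=> i i'; rewrite /p; case: ifP => // _; case: ifP => _; first exact: perm_inj.
  by move/perm_inj/perm_inj.
have eqj (j j' : 'I_k) : j = j' :> nat -> j = j' by apply: ord_inj.
apply: (@firecracker_labelling _ _ (fun i j => (a j + 2 * p i j)%N)).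
- move=> i j i' j' e; have l1 := ltn_ord (p i j); have l2 := ltn_ord (p i' j').
  have jj' : j = j' by apply: ord_inj; rewrite /a in e; nia.
  by split=> //; move: e; rewrite jj' => e; apply: (pinj j'); apply: ord_inj; lia.
- by move=> i j; rewrite oddD oa mul2n odd_double.
- by move=> i j; have := aX j; have := ltn_ord (p i j); lia.
- move=> i i' j /(eqj j j0)-> ii'; rewrite /p eqxx ii' /a muln0 /= muln0 !add1n.
  exact: coprime_consecutive_odd.
move=> i j j' /(eqj j j1)-> jj'; rewrite /p eqxx (_ : j1 == j0 = false) //.
case: eqP => [->|_]; first by rewrite coprime_sym.
by rewrite (negbTE jj').
Qed.

Local Close Scope ring_scope.

(** With [k = d + 21] this reads [4608 * k ^ 2 <= 2 ^ k]; together with [2 ^ k <= 2 * (n * k)] it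
    gives [n >= 2304 * k]. *)
Lemma sqr_leq_exp2 d : 9 * (d + 21) ^ 2 <= 2 ^ (d + 12).
Proof.
elim: d => // d IH; rewrite !addSn (expnS 2 (d + 12)); move: (2 ^ _) IH => y; nia.
Qed.

Theorem theorem4p7 (n k : nat) : 1 < n -> 3 <= k -> odd_prime (firecracker n k).
Proof.
move=> n1 k3; have [k20|k20] := leqP k 20; first exact: odd_prime_small_star.
have [lt|ge] := ltnP (2 * (n * k)) (2 ^ k); first exact: odd_prime_few_stars.
apply: odd_prime_many_stars; first exact: leq_trans k3.
have := sqr_leq_exp2 (k - 21); rewrite subnK // => h.
have e : 2 ^ k = 512 * 2 ^ (k - 21 + 12).
  by rewrite (_ : 512 = 2 ^ 9) // -expnD; congr (2 ^ _); lia.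
have k0 : 0 < k by apply: leq_trans k3.
move: ge h; rewrite e; move: (2 ^ _) => y ge h.
by rewrite -(leq_pmul2r k0); nia.
Qed.
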